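(* Let $I$ be a monomial ideal in $R=k[x_1, \ldots, x_n]$, where $k$ is a field, and let $I^{\mathrm{pol}}\subset R^{\mathrm{pol}}$ be its polarization. Then the maximal length of an initially regular sequence on $R^{\mathrm{pol}}/I^{\mathrm{pol}}$ is at least $\sum_{i=1}^n(d_{x_i}(I)-1)$, which is the number of polarizing variables.
   Context: For a monomial ideal $J$ and a variable $x$, $d_x(J)$ is the maximum power of $x$ appearing in the minimal monomial generators of $J$. Polarization: with $d_i=d_{x_i}(I)$, the variable $x_i$ is polarized by the variables $x_{i,1}=x_i, x_{i,2},\dots,x_{i,d_i}$, where $x_{i,2},\dots,x_{i,d_i}$ are new variables (the polarizing variables); $R^{\mathrm{pol}}$ is the polynomial ring over $k$ obtained from $R$ by adjoining all of these new variables, and $I^{\mathrm{pol}}$ is the squarefree monomial ideal generated by the monomials $\prod_{i=1}^n\prod_{j=1}^{a_i}x_{i,j}$, one for each minimal monomial generator $\prod_{i=1}^n x_i^{a_i}$ of $I$. Initially regular sequences: let $S$ be a polynomial ring over a field, fix a set of term orders $>_1,\dots,>_q$ on $S$ (these may differ from one another or all be the same), and let $J\subseteq S$ be a proper ideal. Write $\mathrm{in}_{>}(J)$ for the initial ideal of $J$ with respect to a term order $>$. A sequence of nonconstant polynomials $f_1,\dots,f_q$ is an initially regular sequence on $S/J$ (with respect to $>_1,\dots,>_q$) if for each $i=1,\dots,q$, $f_i$ is a regular element (that is, a non-zerodivisor) on $S/J_i$, where $J_1=\mathrm{in}_{>_1}(J)$ and $J_i=\mathrm{in}_{>_i}(J_{i-1},f_{i-1})$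 for $i\ge 2$. In the claim, the term orders are not prescribed: an initially regular sequence means one with respect to some choice of term orders on $R^{\mathrm{pol}}$. *)

(* Defs.v *)
From mathcomp Require Import all_boot all_order all_algebra.
From mathcomp Require Import mpoly.
From Stdlib Require Import ClassicalEpsilon.

Set Implicit Arguments.
Unset Strict Implicit.
Unset Printing Implicit Defensive.

Import GRing.Theory.
Local Open Scope ring_scope.

(* Ideals are Prop-valued predicates: membership is not assumed decidable. *)

Definition is_ideal (A : comNzRingType) (J : A -> Prop) : Prop :=
  [/\ J 0,
      forall a b, J a -> J b -> J (a + b)
    & forall r a, J a -> J (r * a)].

Definition gen_ideal (A : comNzRingType) (G : A -> Prop) : A -> Prop :=
  fun a => forall J : A -> Prop,
    is_ideal J -> (forall g, G g -> J g) -> J a.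

Definition add_gen (A : comNzRingType) (J : A -> Prop) (f : A) : A -> Prop :=
  gen_ideal (fun a => J a \/ a = f).

(* A regular element on M = A/J: a non-zerodivisor on M with fM <> M.  The
   second condition says that (J, f) is a proper ideal; without it every
   element would be regular on the zero module. *)
Definition regular_on (A : comNzRingType) (J : A -> Prop) (f : A) : Prop :=
  (forall a, J (f * a) -> J a) /\ ~ add_gen J f 1.

Section MonomialIdeals.
Variables (k : fieldType) (n : nat).
Implicit Types (I : {mpoly k[n]} -> Prop) (m : 'X_{1..n}).

Definition monomial_ideal I : Prop :=
  exists M : 'X_{1..n} -> Prop,
    forall p, I p <-> gen_ideal (fun q => exists2 m, M m & q = 'X_[m]) p.

Definition min_gen I m : Prop :=
  I 'X_[m] /\ forall m', I 'X_[m'] -> (m' <= m)%MM -> m' = m.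

(* The least upper bound of the exponents of x_i in the minimal generators:
   their maximum, or 0 when there are none (I = 0). *)
Definition is_max_exp I (i : 'I_n) (e : nat) : Prop :=
  (forall m, min_gen I m -> (m i <= e)%N) /\
  (forall e', (forall m, min_gen I m -> (m i <= e')%N) -> (e <= e')%N).

(* d_{x_i}(I); for a monomial ideal I the maximum exists by Dickson's lemma. *)
Definition dx I (i : 'I_n) : nat := epsilon (inhabits 0%N) (is_max_exp I i).

End MonomialIdeals.

Section InitialIdeals.
Variables (k : fieldType) (n : nat).
Implicit Types (J : {mpoly k[n]} -> Prop) (le : rel 'X_{1..n}).

Definition term_order le : Prop :=
  [/\ total le, antisymmetric le, transitive le,
      forall m, le 0%MM m
    & forall m m1 m2, le m1 m2 -> le (m1 + m)%MM (m2 + m)%MM].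

Definition is_lead_mon le (p : {mpoly k[n]}) (m : 'X_{1..n}) : Prop :=
  m \in msupp p /\ {in msupp p, forall m', le m' m}.

(* A polynomial with a leading monomial is nonzero, so 0 contributes nothing. *)
Definition initial_ideal le J : {mpoly k[n]} -> Prop :=
  gen_ideal (fun q => exists p m, [/\ J p, is_lead_mon le p m & q = 'X_[m]]).

(* Everything is numbered from 0: with f_0, f_1, ... the entries of fs,
   [irs_ideal ord J fs i] is J_i, where J_0 = in_{ord 0}(J) and
   J_{i+1} = in_{ord (i+1)}(J_i, f_i). *)
Fixpoint irs_ideal (ord : nat -> rel 'X_{1..n}) J (fs : seq {mpoly k[n]})
    (i : nat) : {mpoly k[n]} -> Prop :=
  match i with
  | 0%N => initial_ideal (ord 0%N) J
  | i'.+1 => initial_ideal (ord i'.+1) (add_gen (irs_ideal ord J fs i') fs`_i')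
  end.

(* Only the first [size fs] orders matter.  If fs is nonempty, properness of J
   follows from the regularity of its first entry. *)
Definition initially_regular (ord : nat -> rel 'X_{1..n}) J
    (fs : seq {mpoly k[n]}) : Prop :=
  forall i, (i < size fs)%N ->
    [/\ term_order (ord i),
        forall c : k, fs`_i != c%:MP
      & regular_on (irs_ideal ord J fs i) fs`_i].

Definition is_max_initially_regular_length J (q : nat) : Prop :=
  (exists ord fs, initially_regular ord J fs /\ size fs = q) /\
  (forall ord fs, initially_regular ord J fs -> (size fs <= q)%N).

End InitialIdeals.

Section Polarization.
Variables (k : fieldType) (n : nat) (I : {mpoly k[n]} -> Prop).

(* The variables of R^pol.  The pair (i, j), with j numbered from 0, stands for
   x_{i,j+1}; (i, 0) is x_i itself, which is present even if d_{x_i}(I) = 0. *)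
Definition polvar : finType := {i : 'I_n & 'I_(maxn 1 (dx I i))}.

Definition polvar_mk (i : 'I_n) (j : 'I_(maxn 1 (dx I i))) : polvar :=
  Tagged (fun i => 'I_(maxn 1 (dx I i))) j.

Definition polarizing_vars : {set polvar} :=
  [set v : polvar | (0 < tagged v)%N].

Definition pol_mon (m : 'X_{1..n}) : {mpoly k[#|polvar|]} :=
  \prod_(i < n) \prod_(j < maxn 1 (dx I i) | (j < m i)%N)
     'X_(enum_rank (polvar_mk j)).

Definition polarization : {mpoly k[#|polvar|]} -> Prop :=
  gen_ideal (fun p => exists2 m, min_gen I m & p = pol_mon m).

End Polarization.

Arguments polarizing_vars {k n} I.
Arguments polvar_mk {k n} I i j.
Arguments pol_mon {k n} I m.
Arguments polarization {k n} I _.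

(* Main.v *)
(* For the lower bound take the differences x_{i,j} - x_{i,1}, j > 1, in any
   order, with a term order making x_{i,j} > x_{i,1}.  After some of these steps
   the ideal consists of the variables x_{i,j} already used together with the
   image of I^pol under x_{i,j} |-> x_{i,1} for those variables.  A binomial
   x_v - x_r is regular modulo a monomial ideal as soon as no monomial outside
   the ideal is multiplied into it by both x_v and x_r, and this holds here
   because the monomial of a generator g contains exactly the x_{i,j} with
   j <= g_i, so that any two generators are nested inside each block.

   That a maximal length exists follows from the count h_J(D) of monomials of
   degree < D outside J: if f is regular modulo a monomial ideal J, then
   D h_{in(J,f)}(D) <= h_J(D (1 + deg f)), so a sequence of length q forces
   D^q = O(D^N), where N is the number of variables. *)

Require Import Defs.
From mathcomp Require Import all_boot all_order all_algebra.
From mathcomp Require Import mpoly.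
From mathcomp Require Import zify.
From Stdlib Require Import ClassicalEpsilon.

Set Implicit Arguments.
Unset Strict Implicit.
Unset Printing Implicit Defensive.

Import Order.TTheory GRing.Theory.
Local Open Scope ring_scope.

(** * Generated ideals *)

Section Ideals.
Variable A : comNzRingType.
Implicit Types (J : A -> Prop) (G : A -> Prop).

Lemma ideal_sum J (hJ : is_ideal J) (T : eqType) (r : seq T) (F : T -> A) :
  (forall i, i \in r -> J (F i)) -> J (\sum_(i <- r) F i).
Proof.
case: hJ => J0 JD _ hF; rewrite big_seq.
by elim/big_ind: _ => // i; apply: hF.
Qed.

Lemma ideal_opp J (hJ : is_ideal J) a : J a -> J (- a).
Proof. by case: hJ => _ _ JM Ja; rewrite -mulN1r; apply: JM. Qed.

Lemma gen_ideal_ideal G : is_ideal (gen_ideal G).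
Proof.
split=> [J [] //|a b Ga Gb J hJ hG|r a Ga J hJ hG]; case: (hJ) => _ JD JM.
  by apply: JD; [apply: Ga | apply: Gb].
by apply: JM; apply: Ga.
Qed.

Lemma gen_ideal_gen G a : G a -> gen_ideal G a.
Proof. by move=> Ga J _; apply. Qed.

Lemma add_gen_base J f a : J a -> add_gen J f a.
Proof. by move=> Ja; apply: gen_ideal_gen; left. Qed.

Lemma add_gen_mul J f a : add_gen J f (a * f).
Proof.
by case: (gen_ideal_ideal (fun a => J a \/ a = f)) => _ _; apply;
  apply: gen_ideal_gen; right.
Qed.

End Ideals.

Lemma eq_initial_ideal (k : fieldType) (n : nat) (le : rel 'X_{1..n})
    (J J' : {mpoly k[n]} -> Prop) :
  (forall p, J p <-> J' p) ->
  forall p, initial_ideal le J p <-> initial_ideal le J' p.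
Proof.
move=> eqJ p; split=> h K hK hG; apply: h => // q [q0 [m [Jq lm ->]]];
  by apply: hG; exists q0, m; split=> //; apply/eqJ.
Qed.

Lemma eq_add_gen (A : comNzRingType) (J J' : A -> Prop) f :
  (forall p, J p <-> J' p) -> forall p, add_gen J f p <-> add_gen J' f p.
Proof.
move=> eqJ p; split=> h K hK hG; apply: h => // q [Jq|->]; apply: hG; auto;
  by left; apply/eqJ.
Qed.

(** * Monomial ideals as upward closed sets of exponents *)

Section MonoIdeals.
Variables (k : fieldType) (n : nat).
Implicit Types (W M : 'X_{1..n} -> Prop) (p q : {mpoly k[n]}) (m : 'X_{1..n}).

Definition upset W := forall m m', W m -> (m <= m')%MM -> W m'.

(** For an [upset] W this is the monomial ideal whose set of monomials is W, so that ideals can be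
    handled through their exponents. *)
Definition mono_ideal W : {mpoly k[n]} -> Prop :=
  fun p => forall m, m \in msupp p -> W m.

Definition up_closure M : 'X_{1..n} -> Prop :=
  fun m => exists2 m0, M m0 & (m0 <= m)%MM.

Lemma up_closure_upset M : upset (up_closure M).
Proof. by move=> m m' [m0 Mm0 le0] le; exists m0 => //; apply: lepm_trans le. Qed.

Lemma eq_mono_ideal W W' :
  (forall m, W m <-> W' m) -> forall p, mono_ideal W p <-> mono_ideal W' p.
Proof. by move=> eqW p; split=> h m /h /eqW. Qed.

Lemma mono_idealX W m : mono_ideal W 'X_[m] <-> W m.
Proof.
split=> [|Wm m']; first by apply; rewrite msuppX inE.
by rewrite msuppX inE => /eqP->.
Qed.

Lemma mono_ideal_ideal W : upset W -> is_ideal (mono_ideal W).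
Proof.
move=> uW; split=> [m|p q Wp Wq m|q p Wp m].
- by rewrite -mpolyC0 msupp0.
- by move/msuppD_le; rewrite mem_cat => /orP[/Wp|/Wq].
by move/msuppM_le/allpairsP=> [[m1 m2] /= [_ /Wp Wm2 ->]]; apply/(uW _ _ Wm2)/lem_addl.
Qed.

Lemma gen_ideal_mono M p :
  gen_ideal (fun q => exists2 m, M m & q = 'X_[m]) p <->
  mono_ideal (up_closure M) p.
Proof.
split=> [|Wp J hJ hM].
  apply; first exact/mono_ideal_ideal/up_closure_upset.
  by move=> _ [m Mm ->]; apply/mono_idealX; exists m => //; apply: lepm_refl.
rewrite [p]mpolyE; apply: ideal_sum => // m /Wp [m0 Mm0 le0].
case: hJ => _ _ JM; rewrite -mul_mpolyC -(submK le0) mpolyXD mulrA.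
by apply: JM; apply: hM; exists m0.
Qed.

Lemma initial_idealE le (J : {mpoly k[n]} -> Prop) p :
  initial_ideal le J p <->
  mono_ideal (up_closure (fun m => exists2 q, J q & is_lead_mon le q m)) p.
Proof.
rewrite -gen_ideal_mono; split=> h K hK hG; apply: h => //.
  by move=> q [q0 [m [Jq lm ->]]]; apply: hG; exists m => //; exists q0.
by move=> q [m [q0 Jq lm ->]]; apply: hG; exists q0, m.
Qed.

Lemma lead_exists le p : term_order le -> p != 0 -> exists m, is_lead_mon le p m.
Proof.
case=> tot _ tr _ _; rewrite -msupp_eq0 /is_lead_mon.
elim: (msupp p) => // m [|m1 s] IH _.
  by exists m; split=> [|m']; rewrite !inE // => /eqP->; case/orP: (tot m m).
case: IH => // m0 [m0s hm0]; have refl x : le x x by case/orP: (tot x x).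
case/orP: (tot m m0) => le_m.
  exists m0; split=> [|m']; first by rewrite inE m0s orbT.
  by rewrite inE => /predU1P[-> //|/hm0].
exists m; split=> [|m']; first by rewrite mem_head.
by rewrite inE => /predU1P[-> //|/hm0 h]; apply: tr le_m.
Qed.

End MonoIdeals.

(** * Counting standard monomials, and the upper bound on the length *)

Lemma linear_dependency (F : fieldType) (R C : finType) (M : R -> C -> F) :
  (#|C| < #|R|)%N ->
  exists2 c : R -> F, (exists r, c r != 0) & forall x, \sum_r c r * M r x = 0.
Proof.
move=> ltCR; pose B : 'M_(#|R|, #|C|) := \matrix_(i, j) M (enum_val i) (enum_val j).
have : kermx B != 0.
  rewrite -mxrank_eq0 mxrank_ker -lt0n subn_gt0.
  exact: leq_ltn_trans (rank_leq_col B) _.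
case/rowV0Pn=> v /sub_kermxP vB0 v0.
exists (fun r => v 0 (enum_rank r)).
  case/rV0Pn: v0 => i vi; exists (enum_val i); by rewrite enum_valK.
move=> x; have /matrixP/(_ 0 (enum_rank x)) := vB0.
rewrite !mxE => vB; rewrite -[RHS]vB (reindex (@enum_val R R)) /=; last first.
  by apply: onW_bij; apply: enum_val_bij.
by apply: eq_bigr => i _; rewrite enum_valK !mxE enum_rankK.
Qed.

Section Growth.
Variables (k : fieldType) (n : nat).
Implicit Types (W : 'X_{1..n} -> Prop) (p q f : {mpoly k[n]}) (m : 'X_{1..n}).

Definition decide (P : Prop) : bool :=
  if excluded_middle_informative P then true else false.

Lemma decideP P : reflect P (decide P).
Proof. by rewrite /decide; case: excluded_middle_informative => h; constructor. Qed.

(** Its cardinality is the Hilbert function of the quotient by W, summed over the degrees below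
    D. *)
Definition standard W D : {set 'X_{1..n < D}} :=
  [set m : 'X_{1..n < D} | ~~ decide (W m)].

Lemma mnm_le_mdeg m i : (m i <= mdeg m)%N.
Proof. by rewrite mdegE (bigD1 i) //= leq_addr. Qed.

Lemma card_standard_le W D : (#|standard W D| <= D ^ n)%N.
Proof.
apply: leq_trans (max_card _) _.
pose g (m : 'X_{1..n < D}) : {ffun 'I_n -> 'I_D} :=
  [ffun i => Ordinal (leq_ltn_trans (mnm_le_mdeg m i) (bmdeg m))].
have g_inj : injective g.
  move=> m1 m2 /ffunP eqg; apply/val_inj/mnmP => i.
  by have := eqg i; rewrite !ffunE => /(congr1 val).
by have := leq_card _ g_inj; rewrite card_ffun !card_ord.
Qed.

(** Modulo f the relation reduces to its term [q 0], which therefore lies in (J, f) and vanishes by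
    [hP]; the remaining sum is divisible by f, which cancels, leaving a shorter relation. *)
Lemma nzd_power_independent (J : {mpoly k[n]} -> Prop) (hJ : is_ideal J) f
    (hf : forall a, J (f * a) -> J a) (P : {mpoly k[n]} -> Prop)
    (hP : forall q, P q -> add_gen J f q -> q = 0) D (q : nat -> {mpoly k[n]}) :
  (forall j, P (q j)) -> J (\sum_(j < D) q j * f ^+ j) ->
  forall j, (j < D)%N -> q j = 0.
Proof.
elim: D q => // D IH q Pq; rewrite big_ord_recl expr0 mulr1 /=.
under eq_bigr do rewrite /bump /= add1n exprS mulrCA.
rewrite -mulr_sumr => Jsum.
have q0 : q 0%N = 0.
  apply: hP => //; set s := \sum_(i < _) _ in Jsum.
  case: (gen_ideal_ideal (fun a => J a \/ a = f)) => _ addJ _.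
  rewrite -[q 0%N](addrK (f * s)); apply: addJ; first exact: add_gen_base.
  by rewrite [f * s]mulrC -mulNr; apply: add_gen_mul.
move: Jsum; rewrite q0 add0r => /hf Js [//|j] lt_j.
exact: (IH (fun j => q j.+1)).
Qed.

Lemma msize_Xexp m f j : f != 0 ->
  msize ('X_[m] * f ^+ j) = (mdeg m + j * (msize f).-1).+1.
Proof.
move=> f0; elim: j => [|j IH]; first by rewrite expr0 mulr1 msizeX addn0.
have nz : 'X_[m] * f ^+ j != 0.
  by rewrite -msize_poly_eq0 IH.
rewrite exprSr mulrA msizeM // IH (mpolySpred _ f0) /=; lia.
Qed.

(* The products a f^j with a in A and j < D are linearly independent modulo
   mono_ideal W. *)
Lemma standard_growth W (uW : upset W) f (f0 : f != 0)
    (hf : forall a, mono_ideal W (f * a) -> mono_ideal W a)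
    D (A : {set 'X_{1..n < D}})
    (hA : forall q : {mpoly k[n]}, add_gen (mono_ideal W) f q ->
      (forall m, m \in msupp q -> exists2 a, a \in A & m = a) -> q = 0) :
  (D * #|A| <= #|standard W (D * msize f)|)%N.
Proof.
rewrite leqNgt; apply/negP => ltC.
(* Rows are the products X^a f^j, columns the standard monomials of degree below D [msize f]. With
   more rows than columns, some nontrivial combination has no standard monomial in its support. *)
pose R : finType := ('I_D * {a : 'X_{1..n < D} | a \in A})%type.
pose C : finType := {a : 'X_{1..n < D * msize f} | a \in standard W (D * msize f)}.
pose M (r : R) : {mpoly k[n]} := 'X_[val (val r.2)] * f ^+ r.1.
have [|c [[j0 a0] c0] hc] := @linear_dependency k R C (fun r x => (M r)@_(val (val x))).
  by rewrite card_prod card_ord !card_sig.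
(* [q j] collects the terms of the combination with factor f^j; for j >= D it is 0 by default. *)
pose q (j : nat) : {mpoly k[n]} :=
  if insub j is Some j then
    \sum_(a : {a : 'X_{1..n < D} | a \in A}) c (j, a) *: 'X_[val (val a)] else 0.
have suppq j m : m \in msupp (q j) -> exists2 a, a \in A & m = a.
  rewrite /q; case: insubP => [i _ _|_]; last by rewrite -mpolyC0 msupp0.
  move/msupp_sum_le/flattenP => [_ /mapP[a _ ->]] /msuppZ_le.
  by rewrite msuppX inE => /eqP->; exists (val a) => //; apply: valP.
have sumE : \sum_(j < D) q j * f ^+ j = \sum_r c r *: M r.
  transitivity (\sum_(j < D) \sum_(a : {a | a \in A}) c (j, a) *: M (j, a)).
    apply: eq_bigr => j _; rewrite /q valK mulr_suml.
    by apply: eq_bigr => a _; rewrite scalerAl.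
  by rewrite pair_bigA /=; apply: eq_bigr => -[j a] _.
have Jsum : mono_ideal W (\sum_(j < D) q j * f ^+ j).
  rewrite sumE => m hm; apply/decideP/negPn/negP => hW.
  (* The degree is below D + D deg f, which is D [msize f]. A monomial outside W would thus be a
     column, where the coefficient is 0. *)
  have lt_m : (mdeg m < D * msize f)%N.
    have /flattenP[_ /mapP[r _ ->]] := msupp_sum_le hm.
    move/msuppZ_le/msize_mdeg_lt => /leq_trans; apply.
    rewrite msize_Xexp // [msize f in leqRHS](mpolySpred _ f0) mulnS -addSn.
    by apply: leq_add; [apply: bmdeg | rewrite leq_mul2r ltnW ?orbT].
  have xS : BMultinom lt_m \in standard W (D * msize f) by rewrite inE.
  have /= := hc (exist _ (BMultinom lt_m) xS).
  move: hm; rewrite mcoeff_msupp raddf_sum /=.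
  by under eq_bigr do rewrite mcoeffZ; move=> h0 h; rewrite h eqxx in h0.
have /(_ j0 (ltn_ord j0)) q0 := nzd_power_independent (mono_ideal_ideal k uW) hf
  (fun q h1 h2 => hA q h2 h1) suppq Jsum.
have : (q j0)@_(val (val a0)) = c (j0, a0).
  rewrite /q valK raddf_sum (bigD1 a0) //= big1 => [|a ne_a].
    by rewrite mcoeffZ mcoeffX eqxx mulr1 addr0.
  rewrite mcoeffZ mcoeffX; case: eqP => [/val_inj/val_inj eqa|]; last by rewrite mulr0.
  by rewrite eqa eqxx in ne_a.
by rewrite q0 mcoeff0 => /esym c00; rewrite c00 eqxx in c0.
Qed.

(** A nonzero element of (W, f) has its leading monomial in W', so it is not a combination of
    monomials outside W'; [standard_growth] applies to these. *)
Lemma initial_growth W (uW : upset W) f (f0 : f != 0)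
    (hf : forall a, mono_ideal W (f * a) -> mono_ideal W a)
    le (hle : term_order le) W'
    (hW' : forall p, initial_ideal le (add_gen (mono_ideal W) f) p <-> mono_ideal W' p) D :
  (D * #|standard W' D| <= #|standard W (D * msize f)|)%N.
Proof.
apply: standard_growth => // q Jq hq; apply/eqP/negPn/negP => q0.
have [m lm] := lead_exists hle q0.
have [a aA ma] := hq m lm.1.
move: aA; rewrite inE => /decideP; apply; rewrite -ma.
apply/(mono_idealX k)/hW'; apply: gen_ideal_gen; exists q, m.
by split.
Qed.

(** [standard_growth] with A = {1}: a nonzero constant in (W, f) would contradict properness. This
    serves the last entry of a sequence. *)
Lemma proper_growth W (uW : upset W) f (f0 : f != 0)
    (hf : regular_on (mono_ideal W) f) D :
  (D <= #|standard W (D * msize f)|)%N.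
Proof.
case: D => // D.
case: hf => hf f1; rewrite -[leqLHS]muln1 -(cards1 (bm0 : 'X_{1..n < D.+1})).
apply: standard_growth => // q Jq hq.
have qC : q = (q@_0%MM)%:MP.
  apply: msize1_polyC; rewrite msizeE; apply/bigmax_leqP_seq => m /hq[a].
  by rewrite inE => /eqP-> -> _; rewrite mdeg0.
rewrite qC; case: (eqVneq q@_0%MM 0) => [->|nz]; first by rewrite mpolyC0.
case: f1; rewrite -mpolyC1 -(mulVf nz) mpolyCM.
by case: (gen_ideal_ideal (fun a => mono_ideal W a \/ a = f)) => _ _; apply; rewrite -qC.
Qed.

Lemma irs_ideal_mono ord (J : {mpoly k[n]} -> Prop) fs i :
  exists2 W, upset W & forall p, irs_ideal ord J fs i p <-> mono_ideal W p.
Proof.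
by case: i => [|i]; refine (ex_intro2 _ _ _ (@up_closure_upset _ _) (@initial_idealE _ _ _ _)).
Qed.

(** Induction on the number of entries left: each entry f multiplies the count by at least D and the
    degree bound by [msize f]. The constant K is independent of D. *)
Lemma irs_growth ord (J : {mpoly k[n]} -> Prop) fs i :
  initially_regular ord J fs -> (i < size fs)%N ->
  exists2 K, (0 < K)%N & forall W, upset W ->
    (forall p, irs_ideal ord J fs i p <-> mono_ideal W p) ->
    forall D, (D ^ (size fs - i) <= #|standard W (D * K)|)%N.
Proof.
move=> hfs; have [d] := ubnP (size fs - i); elim: d i => // d IH i lt_d lt_i.
have [ordi fi reg] := hfs i lt_i.
have f0 : fs`_i != 0 by rewrite -mpolyC0.
have msz : (0 < msize fs`_i)%N by rewrite lt0n msize_poly_eq0.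
have regW W : (forall p, irs_ideal ord J fs i p <-> mono_ideal W p) ->
    regular_on (mono_ideal W) fs`_i.
  case: reg => reg1 reg2 hW; split=> [a /hW/reg1/hW //|/(eq_add_gen fs`_i hW) //].
case: (ltnP i.+1 (size fs)) => lt_i1; last first.
  exists (msize fs`_i) => // W uW hW D.
  have -> : (size fs - i = 1)%N by lia.
  by rewrite expn1; apply: proper_growth => //; apply: regW.
have [|//|K K0 hK] := IH i.+1; first by lia.
have [ordi1 _ _] := hfs i.+1 lt_i1.
exists (K * msize fs`_i)%N => [|W uW hW D]; first by rewrite muln_gt0 K0.
have [W' uW' hW'] := irs_ideal_mono ord J fs i.+1.
have hW1 p : initial_ideal (ord i.+1) (add_gen (mono_ideal W) fs`_i) p <->
    mono_ideal W' p.
  rewrite -hW' /=; apply: eq_initial_ideal; apply: eq_add_gen => x; exact: iff_sym (hW x).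
rewrite mulnA.
apply: leq_trans (initial_growth uW f0 (regW W hW).1 ordi1 hW1 (D * K)).
have -> : (size fs - i = (size fs - i.+1).+1)%N by lia.
rewrite expnS; apply: leq_mul; last exact: hK.
exact: leq_pmulr.
Qed.

Lemma irs_size_le ord (J : {mpoly k[n]} -> Prop) fs :
  initially_regular ord J fs -> (size fs <= n)%N.
Proof.
move=> hfs; rewrite leqNgt; apply/negP => lt_n.
have [K K0 hK] := irs_growth hfs (leq_ltn_trans (leq0n n) lt_n).
have [W uW hW] := irs_ideal_mono ord J fs 0.
(* D = K^n + 1 gives (D K)^n < D^(n+1), whereas a length above n would force D^(n+1) <= (D K)^n. *)
have := leq_trans (hK W uW hW (K ^ n).+1) (card_standard_le _ _).
rewrite subn0 expnMn leqNgt => /negP; apply.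
apply: (@leq_trans ((K ^ n).+1 ^ n.+1)); last by apply: leq_pexp2l.
by rewrite expnS mulnC ltn_pmul2r ?expn_gt0.
Qed.

End Growth.

(** * Exponents under substitutions of variables by variables *)

Section Push.
Variable n : nat.
Implicit Types (m : 'X_{1..n}) (s t : 'I_n -> 'I_n).

(** The exponent of the image of X^m under x_i |-> x_(s i). *)
Definition push s m : 'X_{1..n} := (\sum_i U_(s i) *+ m i)%MM.

Lemma pushE s m u : push s m u = (\sum_(i | s i == u) m i)%N.
Proof.
rewrite mnm_sumE [RHS]big_mkcond; apply: eq_bigr => i _.
by rewrite mulmnE mnm1E; case: eqP; rewrite ?mul1n.
Qed.

Lemma eq_push s t m : s =1 t -> push s m = push t m.
Proof. by move=> eq_st; apply: eq_bigr => i _; rewrite eq_st. Qed.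

Lemma push_comp s t m : push s (push t m) = push (s \o t) m.
Proof.
apply/mnmP => u; rewrite !pushE.
under eq_bigr do rewrite pushE.
rewrite (exchange_big_dep xpredT) //= [RHS]big_mkcond /=.
apply: eq_bigr => i _; case: ifP => [/eqP <-|ne].
  rewrite (big_pred1 (t i)) // => j /=.
  by rewrite [RHS]eq_sym; case: (eqVneq (t i) j) => [<-|_]; rewrite ?eqxx ?andbF.
rewrite big_pred0 // => j.
by case: (eqVneq (t i) j) => [<-|_]; rewrite ?ne ?andbF.
Qed.

Lemma push_le s m1 m2 : (m1 <= m2)%MM -> (push s m1 <= push s m2)%MM.
Proof.
move/mnm_lepP=> le_m; apply/mnm_lepP => u; rewrite !pushE.
by apply: leq_sum => i _; apply: le_m.
Qed.

Lemma push_ge s m i : (m i <= push s m (s i))%N.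
Proof. by rewrite pushE (bigD1 i) //= leq_addr. Qed.

Lemma pushMn s i e : push s (U_(i) *+ e)%MM = (U_(s i) *+ e)%MM.
Proof.
apply/mnmP => u; rewrite pushE mulmnE mnm1E.
under eq_bigr do rewrite mulmnE mnm1E.
rewrite big_mkcond (bigD1 i) //= big1 => [|j /negPf ne].
  by rewrite eqxx mul1n addn0; case: ifP => _; rewrite ?mul1n.
by rewrite [i == j]eq_sym ne if_same.
Qed.

Lemma pushD s m1 m2 : push s (m1 + m2)%MM = (push s m1 + push s m2)%MM.
Proof.
apply/mnmP => u; rewrite mnmDE !pushE -big_split /=.
by apply: eq_bigr => i _; rewrite mnmDE.
Qed.

Lemma push_id s m : (forall i, m i != 0%N -> s i = i) -> push s m = m.
Proof.
move=> hs; rewrite [RHS]multinomUE_id; apply: eq_bigr => i _.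
by case: (eqVneq (m i) 0%N) => [->|/hs->] //; rewrite !mulm0n.
Qed.

Definition collapse (v r : 'I_n) i := if i == v then r else i.

(** The witness u is the part of m free of x_v, which the collapse fixes. *)
Lemma push_collapse v r m : exists u,
  m = (u + U_(v) *+ m v)%MM /\ push (collapse v r) m = (u + U_(r) *+ m v)%MM.
Proof.
have le_v : (U_(v) *+ m v <= m)%MM.
  apply/mnm_lepP => i; rewrite mulmnE mnm1E.
  by case: eqP => [->|]; rewrite ?mul1n.
exists (m - U_(v) *+ m v)%MM; split; first by rewrite submK.
rewrite -{1}(submK le_v) pushD pushMn {2}/collapse eqxx push_id // => i.
rewrite /collapse mnmBE mulmnE mnm1E; case: (eqVneq i v) => // ->.
by rewrite mul1n subnn.
Qed.

(** The factors x_v are exchanged one at a time for the smaller x_r, by compatibility of the order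
    with products. *)
Lemma term_order_push le v r m : term_order le -> le U_(r)%MM U_(v)%MM ->
  le (push (collapse v r) m) m.
Proof.
case=> tot _ tr _ compat le_rv; have [u [mE ->]] := push_collapse v r m.
rewrite [X in le _ X]mE.
rewrite ![(u + _)%MM]addmC.  apply: (compat _).
elim: (m v) => [|e IH]; first by rewrite !mulm0n; case/orP: (tot 0%MM 0%MM).
rewrite !mulmS; apply: (tr (U_(r) + U_(v) *+ e)%MM); last exact: (compat _).
by rewrite ![(U_(r) + _)%MM]addmC; apply: (compat _).
Qed.

End Push.

(** * Binomials x_v - x_r modulo a monomial ideal: initial ideal and regularity *)

Section Specialization.
Variables (k : fieldType) (n : nat).
Implicit Types (W : 'X_{1..n} -> Prop) (p q : {mpoly k[n]}) (m : 'X_{1..n}).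

Definition rename (s : 'I_n -> 'I_n) p : {mpoly k[n]} :=
  mmap (@mpolyC n k) (fun i => 'X_(s i)) p.

Lemma rename_sum s p : rename s p = \sum_(m <- msupp p) p@_m *: 'X_[push s m].
Proof.
rewrite /rename /mmap; apply: eq_bigr => m _; rewrite mul_mpolyC.
by rewrite /mmap1 mprodXnE.
Qed.

Lemma renameX s m : rename s 'X_[m] = 'X_[push s m].
Proof. by rewrite rename_sum msuppX big_seq1 mcoeffX eqxx scale1r. Qed.

Lemma mono_ideal_sub W (J : {mpoly k[n]} -> Prop) p : is_ideal J ->
  (forall m, W m -> J 'X_[m]) -> mono_ideal W p -> J p.
Proof.
move=> hJ hW Wp; rewrite [p]mpolyE; apply: ideal_sum => // m /Wp/hW.
by case: hJ => _ _ JM; rewrite -mul_mpolyC; apply: JM.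
Qed.

Lemma is_lead_monX le m : term_order le -> is_lead_mon le ('X_[m] : {mpoly k[n]}) m.
Proof.
case=> tot _ _ _ _; split; first by rewrite msuppX mem_head.
by move=> m'; rewrite msuppX inE => /eqP->; case/orP: (tot m m).
Qed.

Lemma initial_mono_ideal le W p : term_order le -> upset W ->
  initial_ideal le (mono_ideal W) p <-> mono_ideal W p.
Proof.
move=> hle uW; split=> [|].
  apply; first exact: mono_ideal_ideal.
  by move=> _ [q [m [Wq [/Wq Wm _] ->]]]; apply/mono_idealX.
apply: mono_ideal_sub; first exact: gen_ideal_ideal.
move=> m Wm; apply: gen_ideal_gen; exists 'X_[m], m; split=> //.
  exact/mono_idealX.
exact: is_lead_monX.
Qed.

(** The monomials of the ideal generated by x_v and the image of W under x_v |-> x_r. *)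
Definition spec v r W m := (0 < m v)%N \/
  up_closure (fun m1 => exists2 m0, W m0 & m1 = push (collapse v r) m0) m.

Lemma spec_upset v r W : upset (spec v r W).
Proof.
move=> m m' [m_v|Wm] le_m; last by right; apply: up_closure_upset le_m.
by left; apply: leq_trans m_v _; apply/mnm_lepP.
Qed.

Lemma rename_spec v r W p : mono_ideal W p ->
  mono_ideal (spec v r W) (rename (collapse v r) p).
Proof.
have hJ := mono_ideal_ideal k (@spec_upset v r W).
move=> Wp; rewrite rename_sum; apply: ideal_sum => // m /Wp Wm.
case: hJ => _ _ JM; rewrite -mul_mpolyC; apply/JM/mono_idealX; right.
by exists (push (collapse v r) m); [exists m | apply: lepm_refl].
Qed.

(** The preimage of an ideal under the ring map [rename] is an ideal; here it contains W and also
    x_v - x_r, which is sent to 0. *)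
Lemma add_gen_rename v r W p (hvr : v != r) :
  add_gen (mono_ideal W) ('X_v - 'X_r) p ->
  mono_ideal (spec v r W) (rename (collapse v r) p).
Proof.
move=> h; apply: (h (fun q => mono_ideal (spec v r W) (rename (collapse v r) q))).
  have [J0 JD JM] := mono_ideal_ideal k (@spec_upset v r W).
  split=> [|a b|a b]; rewrite /rename ?raddf0 // ?rmorphD ?rmorphM;
    [exact: JD | exact: JM].
move=> q [|->]; first exact: rename_spec.
have -> : rename (collapse v r) ('X_v - 'X_r) =
    rename (collapse v r) 'X_v - rename (collapse v r) 'X_r by exact: raddfB.
rewrite !renameX.
rewrite -[U_(v)%MM]mulm1n -[U_(r)%MM]mulm1n !pushMn /collapse eqxx.
rewrite eq_sym (negPf hvr) subrr.
by case: (mono_ideal_ideal k (@spec_upset v r W)).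
Qed.

(** The difference of X^m and its image is X^u (x_v^e - x_r^e) with e = [m v], a multiple of x_v -
    x_r. *)
Lemma push_in_add_gen v r W m : W m ->
  add_gen (mono_ideal W) ('X_v - 'X_r) ('X_[push (collapse v r) m] : {mpoly k[n]}).
Proof.
move=> Wm; set J := add_gen _ _.
have hJ : is_ideal J := gen_ideal_ideal _.
have [u [mE ->]] := push_collapse v r m.
case: (hJ) => _ JD JM.
have -> : 'X_[u + U_(r) *+ m v] = 'X_[m] +
   - ('X_[u] * (\sum_(i < m v) 'X_v ^+ ((m v).-1 - i) * 'X_r ^+ i) * ('X_v - 'X_r))
   :> {mpoly k[n]}.
  rewrite -mulrA [_ * ('X_v - _)]mulrC -subrXX mulrBr !mpolyXn -!mpolyXD.
  by rewrite -mE subKr.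
apply: JD; first by apply: add_gen_base; apply/mono_idealX.
by apply: (ideal_opp hJ); apply: add_gen_mul.
Qed.

(* Modulo x_v - x_r every monomial ideal is the extension of its image under
   x_v |-> x_r, and x_v > x_r keeps the leading monomials free of cancellation. *)
Lemma initial_ideal_spec le v r W p (hvr : v != r) : term_order le ->
  le U_(r)%MM U_(v)%MM ->
  initial_ideal le (add_gen (mono_ideal W) ('X_v - 'X_r)) p <->
  mono_ideal (spec v r W) p.
Proof.
move=> hle le_rv; split=> [|].
  apply; first exact/mono_ideal_ideal/spec_upset.
  move=> _ [q [m [Jq [mq hm] ->]]]; apply/mono_idealX.
  case: (posnP (m v)) => [mv0|]; last by left.
  apply: (add_gen_rename hvr Jq).
  (* The collapse fixes m, which is free of x_v. Any m' in the support with image m satisfies m <=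
     m' in the order, hence m' = m by maximality: the leading term does not cancel. *)
  rewrite mcoeff_msupp rename_sum raddf_sum (bigD1_seq m) ?msupp_uniq //=.
  rewrite big_seq_cond big1 ?addr0 => [|m' /andP[m'q ne_m]].
    rewrite mcoeffZ mcoeffX push_id ?eqxx ?mulr1 -?mcoeff_msupp // => i.
    by rewrite /collapse; case: (eqVneq i v) => // ->; rewrite mv0.
  rewrite mcoeffZ mcoeffX; case: eqP => [eqm|]; last by rewrite mulr0.
  have le_m := term_order_push m' hle le_rv; rewrite eqm in le_m.
  case: hle => _ anti _ _ _; case/eqP: ne_m; apply: anti.
  by rewrite le_m hm.
apply: mono_ideal_sub; first exact: gen_ideal_ideal.
have [_ _ JM] := @gen_ideal_ideal {mpoly k[n]} (fun q => exists p m,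
  [/\ add_gen (mono_ideal W) ('X_v - 'X_r) p, is_lead_mon le p m & q = 'X_[m]]).
move=> m [m_v|[_ [m0 Wm0 ->] le_m]].
  have le_m : (U_(v) <= m)%MM by rewrite lep1mP -lt0n.
  rewrite -(submK le_m) mpolyXD; apply: JM; apply: gen_ideal_gen.
  exists ('X_v - 'X_r), U_(v)%MM; split=> //.
    by rewrite -[X in add_gen _ _ X]mul1r; apply: add_gen_mul.
  split=> [|m'].
    rewrite mcoeff_msupp mcoeffB !mcoeffX eqxx eq_mnm1 [r == v]eq_sym (negPf hvr).
    by rewrite subr0 oner_neq0.
  move/msuppB_le; rewrite mem_cat !msuppX !inE => /orP[]/eqP-> //.
  by case: hle => tot _ _ _ _; case/orP: (tot U_(v)%MM U_(v)%MM).
rewrite -(submK le_m) mpolyXD; apply: JM; apply: gen_ideal_gen.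
exists 'X_[push (collapse v r) m0], (push (collapse v r) m0); split=> //.
  exact: push_in_add_gen.
exact: is_lead_monX.
Qed.

Lemma mem_msuppMX p m w : w \in msupp (p * 'X_[m]) ->
  exists2 m', m' \in msupp p & w = (m + m')%MM.
Proof. by rewrite (perm_mem (msuppMX p m)) => /mapP. Qed.

(** The term of p at m contributes to the product at m1 + m; either it survives there, or it is
    cancelled by a term of p shifted by m2. *)
Lemma mono_ideal_binomial_coeff W p m1 m2 m :
  mono_ideal W (p * ('X_[m1] - 'X_[m2])) -> m \in msupp p ->
  W (m1 + m)%MM \/ exists2 m', m' \in msupp p & (m1 + m = m2 + m')%MM.
Proof.
move=> Wp mp; case: (excluded_middle_informative (W (m1 + m)%MM)) => [|nW]; [by left|right].
apply: (@mem_msuppMX p m2); rewrite mcoeff_msupp; apply/eqP => coef0.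
apply/nW/Wp; rewrite mulrBr mcoeff_msupp mcoeffB coef0 subr0 mcoeffMX.
by rewrite -mcoeff_msupp.
Qed.

(* For m in the support of p not in W and of maximal exponent e in x_v, the
   products p (x_v - x_r) and p (x_r^(e+1) - x_v^(e+1)) show that x_v m and
   x_r^(e+1) m lie in W; then hW lowers the power of x_r step by step. *)
Lemma binomial_nzd W v r (uW : upset W) (hvr : v != r)
  (hW : forall m, W (U_(v) + m)%MM -> W (U_(r) + m)%MM -> W m) p :
  mono_ideal W (('X_v - 'X_r) * p) -> mono_ideal W p.
Proof.
move=> Wp m; have [d] := ubnP (msize p - m v); elim: d m => // d IH m lt_d mp.
have Wv : W (U_(v) + m)%MM.
  rewrite mulrC in Wp; have [//|[m' m'p eqm]] := mono_ideal_binomial_coeff Wp mp.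
  (* The cancelling m' has one more factor x_v, so it lies in W by the induction, which runs
     downwards on the exponent of x_v. *)
  rewrite eqm; apply: (uW m'); last exact: lem_addl.
  apply: IH => //; have := congr1 (fun x : 'X_{1..n} => x v) eqm.
  rewrite !mnmDE !mnm1E eqxx eq_sym (negPf hvr) add0n add1n => eqv.
  have := leq_ltn_trans (mnm_le_mdeg m v) (msize_mdeg_lt mp); lia.
have Wr : W (U_(r) *+ (m v).+1 + m)%MM.
  have Wp' : mono_ideal W (p * ('X_[U_(r) *+ (m v).+1] - 'X_[U_(v) *+ (m v).+1])).
    have [_ _ JM] := mono_ideal_ideal k uW.
    rewrite -!mpolyXn -opprB mulrN; apply: (ideal_opp (mono_ideal_ideal k uW)).
    rewrite mulrC subrXX -mulrA mulrCA; exact: (JM _ _ Wp).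
  have [//|[m' m'p eqm]] := mono_ideal_binomial_coeff Wp' mp.
  (* Cancellation is impossible: it would require [m v] >= [m v] + 1. *)
  have := congr1 (fun x : 'X_{1..n} => x v) eqm.
  rewrite !mnmDE !mulmnE !mnm1E eqxx eq_sym (negPf hvr); lia.
elim: (m v).+1 Wr => [|e IHe]; first by rewrite mulm0n add0m.
rewrite mulmS -addmA => We; apply: IHe; apply: hW => //.
by apply: uW Wv _; apply/mnm_lepP => i; rewrite !mnmDE; lia.
Qed.

(** Properness holds because all elements of the ideal have constant coefficient 0. *)
Lemma binomial_regular W v r (uW : upset W) (hvr : v != r)
  (hW : forall m, W (U_(v) + m)%MM -> W (U_(r) + m)%MM -> W m) (W0 : ~ W 0%MM) :
  regular_on (mono_ideal W) ('X_v - 'X_r : {mpoly k[n]}).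
Proof.
split=> [a|h1]; first exact: binomial_nzd.
suff : (1 : {mpoly k[n]})@_0%MM = 0 by rewrite mcoeff1 eqxx => /eqP; rewrite oner_eq0.
apply: (h1 (fun p => p@_0%MM = 0)) => [|g [Wg|->]].
- split=> [|a b a0 b0|a b b0]; first exact: mcoeff0.
    by rewrite mcoeffD a0 b0 addr0.
  by rewrite rmorphM /= b0 mulr0.
- by apply/eqP; rewrite mcoeff_eq0; apply/negP => /Wg.
by rewrite mcoeffB !mcoeffX !mnm1_eq0 subrr.
Qed.

End Specialization.

(** * Successive collapse of variables onto their roots *)

Lemma nth_notin_take (T : eqType) (x0 : T) s i : uniq s -> (i < size s)%N ->
  nth x0 s i \notin take i s.
Proof.
move=> us lt_i; apply/negP => /(nthP x0)[j]; rewrite size_take lt_i => lt_ji.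
rewrite nth_take // => /eqP.
by rewrite nth_uniq ?(ltn_trans lt_ji) // ltn_eqF.
Qed.

Section Collapse.
Variables (k : fieldType) (n : nat) (rt : 'I_n -> 'I_n).
Hypothesis rtK : forall v, rt (rt v) = rt v.
Variable E : 'X_{1..n} -> Prop.
(* Restricted to a fibre of rt, the elements of E form a chain. *)
Hypothesis E_chain : forall e e' v w, E e -> E e' -> (e' v < e v)%N ->
  rt w = rt v -> (e' w <= e w)%N.
Hypothesis E_nz : ~ E 0%MM.
Implicit Types (V s : seq 'I_n) (m : 'X_{1..n}).

Definition to_root V v := if v \in V then rt v else v.

(** The ideal reached after using the differences for V: it is generated by the variables in V and
    the images of E. *)
Definition collapsed V m := (exists2 v, v \in V & (0 < m v)%N) \/
  exists2 e, E e & (push (to_root V) e <= m)%MM.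

Lemma collapsed_upset V : upset (collapsed V).
Proof.
move=> m m' [[v vV m_v]|[e Ee le_e]] le_m.
  by left; exists v => //; apply: leq_trans m_v _; apply/mnm_lepP.
by right; exists e => //; apply: lepm_trans le_m.
Qed.

Lemma collapsed_nil m : collapsed [::] m <-> up_closure E m.
Proof.
have pushE e : push (to_root [::]) e = e by apply: push_id.
split=> [[[]//|[e Ee]]|[e Ee le_e]]; first by rewrite pushE; exists e.
by right; exists e => //; rewrite pushE.
Qed.

Lemma collapsed_proper V : ~ collapsed V 0%MM.
Proof.
case=> [[v _]|[e Ee /mnm_lepP le_e]]; first by rewrite mnm0E.
apply: E_nz; rewrite (_ : 0%MM = e) //; apply/mnmP => i.
have := leq_trans (push_ge (to_root V) e i) (le_e _).
by rewrite !mnm0E leqn0 => /eqP.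
Qed.

(** Only roots gain preimages under [to_root V], and v is not a root. Hence collapsing V leaves
    exponents at v unchanged. *)
Lemma to_root_eq V v i : rt v != v -> v \notin V -> (to_root V i == v) = (i == v).
Proof.
move=> hv vV; rewrite /to_root; case: ifP => // iV.
have /negPf-> : i != v by apply: contraNneq vV => <-.
by apply: contraNF hv => /eqP <-; rewrite rtK.
Qed.

Lemma collapse_to_root V v : rt v != v -> v \notin V ->
  collapse v (rt v) \o to_root V =1 to_root (rcons V v).
Proof.
move=> hv vV i; rewrite /= /collapse to_root_eq // /to_root mem_rcons inE.
by case: eqP => [->|].
Qed.

Lemma spec_collapsed V v m : rt v != v -> v \notin V ->
  spec v (rt v) (collapsed V) m <-> collapsed (rcons V v) m.
Proof.
move=> hv vV; have pushV e : push (to_root (rcons V v)) e =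
    push (collapse v (rt v)) (push (to_root V) e).
  by rewrite push_comp; apply: eq_push => i; rewrite -collapse_to_root.
have fixV w : w \in V -> collapse v (rt v) w = w.
  by rewrite /collapse; case: eqP => // -> wV; rewrite wV in vV.
split=> [[m_v|[_ [m0 [[w wV m0_w]|[e Ee le_e]] ->] le_m]]|[[w]|[e Ee]]].
- by left; exists v; rewrite ?mem_rcons ?mem_head.
- left; exists w; first by rewrite mem_rcons inE wV orbT.
  apply: leq_trans m0_w _; apply: leq_trans (push_ge (collapse v (rt v)) _ _) _.
  by rewrite fixV //; apply/mnm_lepP.
- right; exists e => //; rewrite pushV; apply: lepm_trans le_m.
  exact: push_le.
- rewrite mem_rcons inE => /predU1P[->|wV] m_w; first by left.
  right; exists U_(w)%MM; last by rewrite lep1mP -lt0n.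
  exists U_(w)%MM; first by left; exists w => //; rewrite mnm1E eqxx.
  by rewrite -[U_(w)%MM]mulm1n pushMn fixV.
move=> le_e; right; exists (push (to_root (rcons V v)) e) => //.
exists (push (to_root V) e); last exact: pushV.
by right; exists e => //; apply: lepm_refl.
Qed.

(** Let the images of e and e' divide x_v m and x_(rt v) m. If e v <= m v, the image of e divides m.
    Otherwise e' v < e v, so e' <= e on the whole fibre; the exponent at the root is then at most
    that of e, hence of m, and the image of e' divides m. *)
Lemma collapsed_colon V v m : rt v != v -> v \notin V ->
  {in V, forall w, rt w != w} ->
  collapsed V (U_(v) + m)%MM -> collapsed V (U_(rt v) + m)%MM -> collapsed V m.
Proof.
move=> hv vV hV; case=> [[w wV]|[e Ee /mnm_lepP le_e]].
  rewrite mnmDE mnm1E; case: eqP => [eq_vw|_ m_w]; first by rewrite eq_vw wV in vV.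
  by left; exists w.
case=> [[w wV]|[e' Ee' /mnm_lepP le_e']].
  rewrite mnmDE mnm1E; case: eqP => [eq_vw|_ m_w]; last by left; exists w.
  (* A variable of V is never a root, so it differs from [rt v]. *)
  by have := hV w wV; rewrite -eq_vw rtK eqxx.
case: (leqP (e v) (m v)) => [le_v|lt_v].
  right; exists e => //; apply/mnm_lepP => u; have := le_e u.
  rewrite mnmDE mnm1E; case: eqP => // <- _.
  by rewrite pushE (big_pred1 v) // => i; rewrite /= to_root_eq.
have e'v : (e' v < e v)%N.
  apply: leq_ltn_trans lt_v; have := le_e' v.
  rewrite mnmDE mnm1E (negPf hv) pushE (big_pred1 v) // => i.
  by rewrite /= to_root_eq.
right; exists e' => //; apply/mnm_lepP => u; have := le_e' u.
rewrite mnmDE mnm1E; case: eqP => // <- _.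
have := le_e (rt v); rewrite mnmDE mnm1E eq_sym (negPf hv) => /(leq_trans _); apply.
(* Every i sent to the root lies in the fibre of v, where the chain condition applies. *)
rewrite !pushE; apply: leq_sum => i /eqP rti.
apply: (E_chain Ee Ee' e'v); rewrite -[RHS]rtK -rti /to_root.
by case: ifP; rewrite ?rtK.
Qed.

Variable le : rel 'X_{1..n}.
Hypothesis hle : term_order le.
Hypothesis le_rt : forall v, rt v != v -> le U_(rt v)%MM U_(v)%MM.

Definition root_differences s : seq {mpoly k[n]} := [seq 'X_v - 'X_(rt v) | v <- s].

Lemma irs_collapsed J s i p : (forall q, J q <-> mono_ideal (collapsed [::]) q) ->
  uniq s -> {in s, forall v, rt v != v} -> (i <= size s)%N ->
  irs_ideal (fun=> le) J (root_differences s) i p <->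
  mono_ideal (collapsed (take i s)) p.
Proof.
move=> hJ us hs; elim: i p => [|i IH] p lt_i.
  rewrite take0 -(initial_mono_ideal _ hle (@collapsed_upset _)).
  exact: eq_initial_ideal.
have v0 : 'I_n by case: (s) lt_i.
have vs : nth v0 s i \in s by exact: mem_nth.
have vV : nth v0 s i \notin take i s by apply: nth_notin_take.
rewrite /= (nth_map v0) // (take_nth v0) //.
rewrite -(eq_mono_ideal (fun m => spec_collapsed m (hs _ vs) vV)).
rewrite -(initial_ideal_spec _ _ _ hle); last exact: le_rt (hs _ vs).
  by apply: eq_initial_ideal; apply: eq_add_gen => q; apply: IH; apply: ltnW.
by rewrite eq_sym hs.
Qed.

Lemma root_differences_regular J s : (forall q, J q <-> mono_ideal (collapsed [::]) q) ->
  uniq s -> {in s, forall v, rt v != v} ->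
  initially_regular (fun=> le) J (root_differences s).
Proof.
move=> hJ us hs i; rewrite size_map => lt_i.
have v0 : 'I_n by case: (s) lt_i.
have vs : nth v0 s i \in s by exact: mem_nth.
have vV : nth v0 s i \notin take i s by apply: nth_notin_take.
have hv := hs _ vs; rewrite (nth_map v0) //; split=> // [c|].
  apply/eqP => /(congr1 (mcoeff U_(nth v0 s i)%MM)).
  rewrite mcoeffB !mcoeffX eqxx eq_mnm1 (negPf hv) subr0 mcoeffC mnm1_eq0 mulr0.
  by apply/eqP; apply: oner_neq0.
have vr : nth v0 s i != rt (nth v0 s i) by rewrite eq_sym.
have hV : {in take i s, forall w, rt w != w} by move=> w /mem_take/hs.
have [reg1 reg2] := binomial_regular k (@collapsed_upset _) vr
  (fun m => @collapsed_colon _ _ m hv vV hV) (@collapsed_proper _).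
have irsE q := irs_collapsed q hJ us hs (ltnW lt_i).
by split=> [a /irsE/reg1/irsE //|/(eq_add_gen _ irsE)].
Qed.

End Collapse.

(** * A term order placing chosen variables above the others *)

Section WeightOrder.
Variables (n : nat) (P : pred 'I_n).
Implicit Types m : 'X_{1..n}.

Definition weight m := (\sum_(i | P i) m i)%N.

Definition weight_le : rel 'X_{1..n} :=
  fun m1 m2 => (weight m1 < weight m2)%N || (weight m1 == weight m2) && (m1 <= m2)%O.

Lemma weightD m1 m2 : weight (m1 + m2)%MM = (weight m1 + weight m2)%N.
Proof. by rewrite /weight -big_split; apply: eq_bigr => i _; rewrite mnmDE. Qed.

Lemma weightU i : weight U_(i)%MM = P i.
Proof.
rewrite /weight big_mkcond (bigD1 i) //= big1 => [|j /negPf ne].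
  by rewrite mnm1E eqxx addn0; case: (P i).
by rewrite mnm1E eq_sym ne if_same.
Qed.

Lemma weight_order : term_order weight_le.
Proof.
rewrite /weight_le; split.
- by move=> m1 m2; case: ltngtP => //= _; apply: le_total.
- by move=> m1 m2; case: ltngtP => //= _; apply: le_anti.
- move=> m2 m1 m3 /orP[lt12|/andP[/eqP-> le12]] /orP[lt23|/andP[/eqP<- le23]].
  + by rewrite (ltn_trans lt12 lt23).
  + by rewrite lt12.
  + by rewrite lt23.
  + by rewrite eqxx (le_trans le12 le23) orbT.
- move=> m; rewrite {1 3}/weight big1 => [|i _]; last exact: mnm0E.
  by rewrite le0m andbT; case: (weight m).
- by move=> m m1 m2; rewrite !weightD ltn_add2r eqn_add2r lemc_add2l.
Qed.

End WeightOrder.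

(** * The polarization as an instance of the collapse *)

Section PolarizationExponents.
Variables (k : fieldType) (n : nat) (I : {mpoly k[n]} -> Prop).
Local Notation N := #|polvar I|.

Definition pol_exp (g : 'X_{1..n}) : 'X_{1..N} :=
  [multinom ((tagged (enum_val w) : nat) < g (tag (enum_val w)))%N : nat | w < N].

(** Sends x_{i,j} to x_{i,1}; index 0 exists even if [dx I i] is 0, thanks to [maxn 1]. *)
Definition pol_root (w : 'I_N) : 'I_N :=
  enum_rank (polvar_mk I (tag (enum_val w)) (Ordinal (leq_maxl 1 _))).

Lemma pol_rootK w : pol_root (pol_root w) = pol_root w.
Proof. by rewrite {1}/pol_root {1 2}/pol_root enum_rankK. Qed.

Lemma pol_root_tag w w' : pol_root w = pol_root w' ->
  tag (enum_val w) = tag (enum_val w').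
Proof. by move/enum_rank_inj/(congr1 tag). Qed.

Lemma pol_monE g : pol_mon I g = 'X_[pol_exp g].
Proof.
rewrite /pol_mon [pol_exp g]multinomUE_id.
transitivity (\prod_(v : polvar I | ((tagged v : nat) < g (tag v))%N)
   'X_(enum_rank v) : {mpoly k[N]}).
  rewrite (sig_big_dep _ _ (fun i j => 'X_(enum_rank (polvar_mk I i j)))) /=.
  by apply: eq_bigr => -[].
rewrite mprodXE (reindex (@enum_rank (polvar I))) /=; last first.
  by apply: onW_bij; apply: enum_rank_bij.
congr 'X_[_]; rewrite big_mkcond; apply: eq_bigr => v _.
by rewrite mnmE enum_rankK; case: ifP; rewrite ?mulm1n ?mulm0n.
Qed.

Definition pol_exps (e : 'X_{1..N}) := exists2 g, min_gen I g & e = pol_exp g.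

Lemma polarizationE p : polarization I p <-> mono_ideal (up_closure pol_exps) p.
Proof.
rewrite -gen_ideal_mono; split=> h K hK hG; apply: h => //.
  by move=> _ [g mg ->]; apply: hG; exists (pol_exp g); [exists g | exact: pol_monE].
by move=> _ [_ [g mg ->] ->]; apply: hG; exists g; rewrite ?pol_monE.
Qed.

(** In block i the exponent of g is the indicator of j < g_i; a strict inequality at one place
    forces g'_i < g_i. *)
Lemma pol_exps_chain e e' v w : pol_exps e -> pol_exps e' -> (e' v < e v)%N ->
  pol_root w = pol_root v -> (e' w <= e w)%N.
Proof.
move=> [g _ ->] [g' _ ->]; rewrite !mnmE => lt_v /pol_root_tag; move: lt_v.
move: (tagged (enum_val w) : nat) (tagged (enum_val v) : nat) => a b lt_v ->.
lia.
Qed.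

Lemma pol_exps_nz : ~ I 'X_[0%MM] -> ~ pol_exps 0%MM.
Proof.
move=> nI [g [Ig _] eg]; apply: nI; rewrite (_ : 0%MM = g) //.
apply/mnmP => i; rewrite mnm0E.
have := congr1 (fun x : 'X_{1..N} =>
  x (enum_rank (polvar_mk I i (Ordinal (leq_maxl 1 _))))) eg.
by rewrite mnm0E mnmE enum_rankK /=; case: (g i).
Qed.

(** The only minimal generator of the unit ideal is 1, so 0 is a maximum; the value chosen by
    [epsilon] is then also least, hence 0. *)
Lemma dx_unit i : I 'X_[0%MM] -> dx I i = 0%N.
Proof.
move=> I1; have max0 : is_max_exp I i 0.
  split=> // m [_ /(_ _ I1) h]; rewrite -h ?mnm0E //.
  by apply/mnm_lepP => j; rewrite mnm0E.
have [_ /(_ 0%N)] := epsilon_spec (inhabits 0%N) _ (ex_intro _ _ max0).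
by rewrite -/(dx I i) leqn0 => h; apply/eqP/h; case: max0.
Qed.

Lemma card_polarizing_vars : #|polarizing_vars I| = (\sum_(i < n) (dx I i - 1))%N.
Proof.
rewrite cardsE -sum1_card.
transitivity (\sum_(i < n) \sum_(j < maxn 1 (dx I i) | (0 < j)%N) 1)%N.
  by rewrite (sig_big_dep _ _ (fun i j => 1%N)).
(* Truncated subtraction makes this hold for [dx I i] = 0 too, where the block is x_i alone. *)
apply: eq_bigr => i _; have -> : maxn 1 (dx I i) = (dx I i - 1).+1 by lia.
by rewrite big_mkcond big_ord_recl /= sum_nat_const card_ord muln1.
Qed.

Lemma polarizing_regular_sequence : ~ I 'X_[0%MM] ->
  exists ord fs, initially_regular ord (polarization I) fs /\
    size fs = #|polarizing_vars I|.
Proof.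
(* The weight counts the variables x_{i,j} with j > 1, which therefore exceed their roots. *)
move=> nI; pose le := weight_le [pred w | pol_root w != w].
pose s := [seq enum_rank v | v <- enum (polarizing_vars I)].
exists (fun=> le), (root_differences k pol_root s); split; last first.
  by rewrite !size_map -cardE.
apply: (root_differences_regular pol_rootK pol_exps_chain (pol_exps_nz nI)).
- exact: weight_order.
- move=> v hv; rewrite /le /weight_le !weightU /= pol_rootK eqxx hv.
  by [].
- move=> q; rewrite polarizationE; apply: eq_mono_ideal => m; exact: iff_sym (collapsed_nil _ _ _).
- by rewrite map_inj_uniq ?enum_uniq //; apply: enum_rank_inj.
move=> x /mapP[v]; rewrite mem_enum inE => v_pos ->.
apply/eqP => /enum_rank_inj; rewrite enum_rankK => eqv.
by move: v_pos; rewrite -eqv.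
Qed.

End PolarizationExponents.

Theorem theorem4p19 (k : fieldType) (n : nat) (I : {mpoly k[n]} -> Prop)
    (hI : monomial_ideal I) :
  (exists q : nat,
     is_max_initially_regular_length (polarization I) q /\
     (\sum_(i < n) (dx I i - 1) <= q)%N) /\
  #|polarizing_vars I| = (\sum_(i < n) (dx I i - 1))%N.
Proof.
split; last exact: card_polarizing_vars.
pose is_length q := exists ord fs, initially_regular ord (polarization I) fs /\ size fs = q.
have exS : is_length (\sum_(i < n) (dx I i - 1))%N.
  case: (excluded_middle_informative (I 'X_[0%MM])) => [I1|nI].
    (* For the unit ideal the sum is 0 and the empty sequence suffices. *)
    rewrite big1 => [|i _]; last by rewrite dx_unit.
    by exists (fun _ _ _ => true), [::].
  by rewrite -card_polarizing_vars; apply: polarizing_regular_sequence.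
have exP : exists q, decide (is_length q) by exists (\sum_(i < n) (dx I i - 1))%N; apply/decideP.
(* Lengths are bounded by the number of variables of R^pol, so a maximal one exists. *)
have ubP q : decide (is_length q) -> (q <= #|polvar I|)%N.
  by move/decideP=> [ord [fs [/irs_size_le h <-]]].
case: (ex_maxnP exP ubP) => q /decideP hq max_q.
exists q; split; last by apply/max_q/decideP.
by split=> // ord fs hfs; apply/max_q/decideP; exists ord, fs.
Qed.
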